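(* Let $J\in\{[0,\infty),\mathbb{R}\}$, let $X$ be a real Banach space and let $E=X\oplus iX$ be its complexification. (i) $C_0(J,E)$ has the stronger $(\Delta)$ property (S$\Delta$P): if $u: J\to E$ is a function with $\Delta_s u\in C_0(J,E)$ for each $s>0$, then $u\in C(J,E)$ and $u-M_hu\in C_0(J,E)$ for each $h>0$. (ii) $\Delta C_0(J,E)$ has $(\Delta)$: if $f\in L^1_{loc}(J,E)$ and $\Delta_s f\in\Delta C_0(J,E)$ for each $s>0$, then $f-M_hf\in\Delta C_0(J,E)$ for each $h>0$.
   Context: $E=X\oplus iX$ is the complex linear space with multiplication $(a+ib)(y_1+iy_2)=(ay_1-by_2)+i(by_1+ay_2)$, endowed with the (product) topology of the norm $\|y_1+iy_2\|=\max\{\|y_1\|,\|y_2\|\}$ (or any of the equivalent norms $(\|y_1\|^p+\|y_2\|^p)^{1/p}$, $1\le p<\infty$). For $f:J\to E$ and $s>0$, $(\Delta_s f)(t)=f(t+s)-f(t)$. For $f\in L^1_{loc}(J,E)$ and $h>0$, $M_hf(t)=\frac1h\int_0^h f(t+s)\,ds$, $t\in J$. $C(J,E)$ and $C_0(J,E)$ denote the spaces of continuous functions and of continuous functions vanishing at infinity from $J$ to $E$; $\Delta C_0(J,E)=\{\phi\in L^1_{loc}(J,E): \Delta_h\phi\in C_0(J,E)\text{ for all }h>0\}$. *)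

(* Defs.v *)
From mathcomp Require Import all_boot all_order all_algebra.
From mathcomp Require Import complex.
From mathcomp Require Import all_classical all_reals all_analysis.

Set Implicit Arguments.
Unset Strict Implicit.
Unset Printing Implicit Defensive.

Import Order.TTheory GRing.Theory Num.Theory.
Import numFieldNormedType.Exports.

Local Open Scope classical_set_scope.
Local Open Scope ring_scope.

Section Bochner.
Context (d : measure_display) (T : measurableType d) (R : realType).
Context (mu : {measure set T -> \bar R}) (V : normedModType R).

Definition integrable_simple (D : set T) (g : T -> V) : Prop :=
  [/\ finite_set (range g),
      forall v, measurable (g @^-1` [set v]) &
      forall v, v != 0 -> (mu (D `&` g @^-1` [set v]) < +oo)%E].

Definition simple_integral (D : set T) (g : T -> V) : V :=
  \sum_(v \in range g) fine (mu (D `&` g @^-1` [set v])) *: v.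

(* The integrand x |-> `|f x - g n x| need not be measurable for the given
   sigma-algebra, but by the second clause it coincides almost everywhere
   with a measurable function, so that its \int, a supremum over the simple
   functions below it, is its integral for the completion of mu. *)
Definition bochner_approx (D : set T) (f : T -> V) (g : nat -> T -> V) : Prop :=
  [/\ forall n, integrable_simple D (g n),
      {ae mu, forall x, D x -> g n x @[n --> \oo] --> f x} &
      (\int[mu]_(x in D) `|f x - g n x|%:E)%E @[n --> \oo] --> 0%E].

Definition bochner_integrable (D : set T) (f : T -> V) : Prop :=
  exists g, bochner_approx D f g.

(* For V complete and f Bochner integrable on the measurable set D, the limit
   exists and depends only on f; 0 is a default value for other f. *)
Definition bochner_integral (D : set T) (f : T -> V) : V :=
  xget 0 [set I | exists2 g, bochner_approx D f g &
                  simple_integral D (g n) @[n --> \oo] --> I].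

End Bochner.

Section Complexification.
Context (R : realType) (X : completeNormedModType R).

(* (y1, y2) stands for y1 + i y2; the norm of a product is the maximum of the
   norms. The library structure is that of a normed space over R; the
   multiplication by complex scalars is [cplx_scale]. *)
Definition complexification : normedModType R := (X * X)%type.

Definition cplx_scale (z : R[i]) (y : complexification) : complexification :=
  let: (a +i* b)%C := z in (a *: y.1 - b *: y.2, b *: y.1 + a *: y.2).

End Complexification.

(* A function on a set J of reals is represented by a function on R whose
   values outside J are irrelevant. J is meant to be closed under t |-> t + s,
   s > 0. Functions are not identified when they agree almost everywhere. *)
Section FunctionSpaces.
Context (R : realType) (X : completeNormedModType R) (J : set R).
Local Notation E := (complexification X).

Definition Delta (s : R) (f : R -> E) : R -> E := fun t => f (t + s) - f t.

Definition Mean (h : R) (f : R -> E) : R -> E := fun t =>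
  cplx_scale (h^-1)%:C%C
    (bochner_integral lebesgue_measure `[0, h] (fun s : R => f (t + s))).

Definition L1loc : set (R -> E) := [set f : R -> E |
  forall K : set R, compact K -> K `<=` J ->
    bochner_integrable lebesgue_measure K f].

Definition Cont : set (R -> E) := [set f | {within J, continuous f}].

Definition C0 : set (R -> E) := [set f | Cont f /\
  forall e : R, 0 < e ->
    exists A : R, forall t, J t -> A < `|t| -> `|f t| < e].

Definition DeltaC0 : set (R -> E) := [set f | L1loc f /\
  forall h : R, 0 < h -> C0 (Delta h f)].

Definition stronger_Delta_property (A : set (R -> E)) : Prop :=
  forall u : R -> E, (forall s : R, 0 < s -> A (Delta s u)) ->
    Cont u /\ forall h : R, 0 < h -> A (u - Mean h u).

Definition Delta_property (A : set (R -> E)) : Prop :=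
  forall f : R -> E, L1loc f -> (forall s : R, 0 < s -> A (Delta s f)) ->
    forall h : R, 0 < h -> A (f - Mean h f).

End FunctionSpaces.

(* Main.v *)
From HB Require Import structures.
Require Import Defs.
From mathcomp Require Import all_boot all_order all_algebra.
From mathcomp Require Import all_classical all_reals all_analysis.
From mathcomp Require Import measurable_realfun zify lra.
Set Implicit Arguments.
Unset Strict Implicit.
Unset Printing Implicit Defensive.
Import Order.TTheory GRing.Theory Num.Theory.
Import numFieldNormedType.Exports.
Local Open Scope classical_set_scope.
Local Open Scope ring_scope.

(** Since every difference of u vanishes at infinity, u s - u t is the pointwise
    limit of the functions s |-> (u (t + m) - u t) - (u (s + m) - u s), which are
    continuous. By Baire's theorem u therefore has arbitrarily small oscillation
    on some interval, and translating by the continuous differences of u makes u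
    continuous everywhere. A second use of Baire's theorem, now in the translation
    parameter, gives that u (t + s) - u t tends to 0 as t tends to infinity
    uniformly for s in [0, h], hence so does u - M_h u. For (ii), M_h commutes with
    the differences, so that (i) applied to each Delta_s f gives the C_0 part, and
    the mean of a locally Bochner integrable function is continuous, hence
    locally integrable. *)

(** * Completeness of a product of complete spaces *)

Section ProductComplete.
Context (R : realType) (X Y : completeNormedModType R).

HB.instance Definition _ := Pointed.on (X * Y)%type.

(** The integration theory below works in a complete range space, and the complexification is the
    product [X * X]. *)
Lemma prod_cauchy_cvg (F : set_system (X * Y)) :
  ProperFilter F -> cauchy F -> cvg F.
Proof.
move=> FF /cauchyP Fc.
have /cauchy_cvgP/cvg_ballP h1 : cauchy (fst @ F).
  apply/cauchyP => e /Fc[x xF]; exists x.1.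
  suff : F (fst @^-1` ball x.1 e) by [].
  by apply: filterS xF => y [].
have /cauchy_cvgP/cvg_ballP h2 : cauchy (snd @ F).
  apply/cauchyP => e /Fc[x xF]; exists x.2.
  suff : F (snd @^-1` ball x.2 e) by [].
  by apply: filterS xF => y [].
apply/cvg_ex; exists (lim (fst @ F), lim (snd @ F)); apply/cvg_ballP => e e0.
by near=> x; split; near: x; [exact: h1|exact: h2].
Unshelve. all: by end_near. Qed.

HB.instance Definition _ := Uniform_isComplete.Build (X * Y)%type prod_cauchy_cvg.

End ProductComplete.

(** * Step functions and their integrals *)

Section StepFunctions.
Context (d : measure_display) (T : measurableType d) (R : realType).
Context (mu : {measure set T -> \bar R}) (V : normedModType R).
Context (D : set T) (mD : measurable D) (fD : (mu D < +oo)%E).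

(** Values lie in an arbitrary type, so that pairs of step functions and integer-valued roundings
    are covered. *)
Definition step (I : Type) (phi : T -> I) :=
  finite_set (range phi) /\ forall i, measurable (phi @^-1` [set i]).

(** The preimage is a finite union of fibres, so [Y] is arbitrary and a step function may be
    composed with any map. *)
Lemma step_preimage (I : choiceType) (phi : T -> I) (Y : set I) :
  step phi -> measurable (phi @^-1` Y).
Proof.
move=> [fphi mphi].
have -> : phi @^-1` Y = \bigcup_(i in range phi `&` Y) phi @^-1` [set i].
  apply/seteqP; split=> [x Yx|x [i [_ Yi] /= xi]]; last by rewrite /preimage/= xi.
  by exists (phi x) => //; split => //; exists x.
by apply: fin_bigcup_measurable => [|i _]; [exact: finite_setIl|exact: mphi].
Qed.

Lemma step_comp (I J : choiceType) (phi : T -> I) (G : I -> J) :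
  step phi -> step (G \o phi).
Proof.
move=> sphi; split=> [|j].
  rewrite (_ : range _ = G @` range phi); last by rewrite image_comp.
  by apply: finite_image; case: sphi.
by rewrite comp_preimage; exact: step_preimage.
Qed.

Lemma step_pair (I J : choiceType) (phi : T -> I) (psi : T -> J) :
  step phi -> step psi -> step (fun x => (phi x, psi x)).
Proof.
move=> [fphi mphi] [fpsi mpsi]; split=> [|[i j]].
  apply: (@sub_finite_set _ _ (range phi `*` range psi)).
    by move=> _ [x _ <-]; split; exists x.
  exact: finite_setX.
rewrite (_ : _ @^-1` _ = phi @^-1` [set i] `&` psi @^-1` [set j]).
  exact: measurableI.
by apply/seteqP; split=> x /= => [[-> ->]//|[-> ->]].
Qed.

Lemma step_measurable_fun (I : choiceType) (phi : T -> I) (H : I -> R)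
    (E : set T) : step phi -> measurable_fun E (H \o phi).
Proof.
move=> sphi mE Y mY; apply: measurableI => //.
by rewrite comp_preimage; exact: step_preimage.
Qed.

Lemma step_integrable_simple (g : T -> V) :
  step g -> integrable_simple mu D g.
Proof.
move=> [fg mg]; split=> // v _; apply: le_lt_trans fD.
by apply: le_measure => //; rewrite ?inE//; exact: measurableI.
Qed.

Lemma integrable_simple_step (E : set T) (g : T -> V) :
  integrable_simple mu E g -> step g.
Proof. by case. Qed.

Let m (I : Type) (phi : T -> I) i := fine (mu (D `&` phi @^-1` [set i])).

Let mE (E : set T) : measurable E -> (mu (D `&` E) \is a fin_num)%E.
Proof.
move=> mE; rewrite ge0_fin_numE//; apply: le_lt_trans fD.
by apply: le_measure => //; rewrite ?inE//; exact: measurableI.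
Qed.

Let measure_comp (I J : choiceType) (phi : T -> I) (G : I -> J) (s : seq I) j :
  step phi -> uniq s -> range phi `<=` [set` s] ->
  m (G \o phi) j = \sum_(i <- s | G i == j) m phi i.
Proof.
move=> [fphi mphi] us sub; rewrite /m sum_fine => [|i _]; last exact: mE.
congr fine; rewrite -big_filter fsbig_seq ?filter_uniq//.
rewrite -measure_fin_bigcup//=.
- congr (mu _); apply/seteqP; split=> [x [Dx Gx]|x [i /= + [Dx xi]]].
    exists (phi x) => //=; rewrite mem_filter; apply/andP; split.
      by rewrite -[X in _ == X]Gx.
    by apply: sub; exists x.
  by rewrite mem_filter => /andP[/eqP <- _]; split=> //=; rewrite xi.
- by move=> i j' _ _ [x [[_ <-] [_ <-]]].
- by move=> i _; exact: measurableI.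
Qed.

(** Grouping the fibres of [phi] by the value of [G] turns a sum over values of [G \o phi] into one
    over values of [phi]. Two step functions can thus be integrated over the common partition given
    by their pair. *)
Lemma simple_integral_comp (I : choiceType) (phi : T -> I) (G : I -> V)
    (s : seq I) : step phi -> uniq s -> range phi `<=` [set` s] ->
  simple_integral mu D (G \o phi) = \sum_(i <- s) m phi i *: G i.
Proof.
move=> sphi us sub.
transitivity (\sum_(v <- undup (map G s)) m (G \o phi) v *: v).
  rewrite /simple_integral; apply: (fsbig_fwiden (undup (map G s))).
  - move=> _ [x _ <-] /=; rewrite mem_undup; apply: map_f; apply: sub.
    by exists x.
  - exact: undup_uniq.
  - move=> v [_ /= nv]; rewrite [_ @^-1` _](_ : _ = set0).
      by rewrite setI0 measure0 scale0r.
    by apply/seteqP; split=> // x xv; apply: nv; exists x.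
under eq_bigr do rewrite (measure_comp _ _ sphi us sub) scaler_suml.
rewrite (exchange_big_dep xpredT)//= big_seq [RHS]big_seq.
apply: eq_bigr => i si.
rewrite -big_filter (_ : seq.filter _ _ = [:: G i]); first by rewrite big_seq1.
under seq.eq_filter do rewrite eq_sym.
rewrite filter_pred1_uniq ?undup_uniq//.
by rewrite mem_undup map_f.
Qed.

(** With [H] the norm, this allows a termwise comparison of the norm of the integral with the
    integral of the norm. *)
Lemma integral_step_comp (I : choiceType) (phi : T -> I) (H : I -> R)
    (s : seq I) : (forall i, 0 <= H i) ->
    step phi -> uniq s -> range phi `<=` [set` s] ->
  (\int[mu]_(x in D) (H (phi x))%:E)%E = (\sum_(i <- s) m phi i * H i)%:E.
Proof.
move=> H0 sphi us sub.
have DE : D = \big[setU/set0]_(i <- s) (D `&` phi @^-1` [set i]).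
  rewrite -bigcup_seq; apply/seteqP; split=> [x Dx|x [i _ []]//].
  by exists (phi x) => //; apply: sub; exists x.
have mphi i : measurable (D `&` phi @^-1` [set i]).
  by apply: measurableI => //; case: sphi.
rewrite [in LHS]DE ge0_integral_bigsetU//=; first last.
- by move=> x _; rewrite lee_fin.
- rewrite -DE; apply/measurable_EFinP; exact: (step_measurable_fun H).
- by move=> i j _ _ [x [[_ <-] [_ <-]]].
rewrite -sumEFin; apply: eq_bigr => i _.
transitivity (\int[mu]_(x in D `&` phi @^-1` [set i]) (cst (H i)%:E x))%E.
  by apply: eq_integral => x /set_mem[_ /= ->].
rewrite integral_cst// mulrC EFinM /m fineK//; apply: mE; case: sphi => _; exact.
Qed.

Lemma simple_integralB (g g' : T -> V) : step g -> step g' ->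
  simple_integral mu D (g - g') =
  simple_integral mu D g - simple_integral mu D g'.
Proof.
move=> sg sg'; have sp := step_pair sg sg'.
have [s ss] : exists s : seq (V * V), [set` s] = range (fun x => (g x, g' x)).
  by case: sp => /finite_seqP[s ->] _; exists s.
have us := undup_uniq s.
have sub : range (fun x => (g x, g' x)) `<=` [set` undup s].
  by rewrite -ss => x /=; rewrite mem_undup.
rewrite (simple_integral_comp (fun p => p.1 - p.2) sp us sub).
rewrite (simple_integral_comp fst sp us sub).
rewrite (simple_integral_comp snd sp us sub).
by rewrite -sumrB; apply: eq_bigr => p _; rewrite scalerBr.
Qed.

Lemma simple_integral_norm (g : T -> V) : step g ->
  (`|simple_integral mu D g|%:E <= \int[mu]_(x in D) `|g x|%:E)%E.
Proof.
move=> sg.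
have [s ss] : exists s : seq V, [set` s] = range g.
  by case: sg => /finite_seqP[s ->] _; exists s.
have us := undup_uniq s.
have sub : range g `<=` [set` undup s].
  by rewrite -ss => x /=; rewrite mem_undup.
rewrite (simple_integral_comp id sg us sub).
rewrite (integral_step_comp (H := fun v => `|v|) _ sg us sub)//.
rewrite lee_fin; apply: le_trans (ler_norm_sum _ _ _) _.
by apply: ler_sum => v _; rewrite normrZ ger0_norm// fine_ge0.
Qed.

Lemma simple_integral_dist (g g' : T -> V) : step g -> step g' ->
  (`|simple_integral mu D g - simple_integral mu D g'|%:E <=
   \int[mu]_(x in D) `|g x - g' x|%:E)%E.
Proof.
move=> sg sg'; rewrite -simple_integralB//; apply: simple_integral_norm.
exact: (step_comp (fun p => p.1 - p.2) (step_pair sg sg')).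
Qed.

End StepFunctions.

(** * Integrals of functions that need not be measurable *)

Section LowerIntegral.
Context (d : measure_display) (T : measurableType d) (R : realType).
Context (mu : {measure set T -> \bar R}).
Local Open Scope ereal_scope.
Import HBNNSimple.

(* The integrands of this section need not be measurable: their \int is a
   lower integral. *)
Lemma le_lower_integral (D D' : set T) (F G : T -> \bar R) :
  (forall x, D x -> 0 <= F x) -> (forall x, D' x -> 0 <= G x) ->
  (forall x, (F \_ D) x <= (G \_ D') x) ->
  \int[mu]_(x in D) F x <= \int[mu]_(x in D') G x.
Proof.
move=> F0 G0 FG; rewrite !ge0_integralE//; apply: ereal_sup_le.
by move=> _ [h /= hF <-]; exists h => //= x; exact: le_trans (hF x) (FG x).
Qed.

(** A simple function below [F] on [D], multiplied by the indicator of the complement of [N], lies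
    below [F] on [D] minus [N] and keeps its integral. *)
Lemma negligible_lower_integral (D N : set T) (F : T -> \bar R) :
  measurable N -> mu N = 0 -> (forall x, 0 <= F x) ->
  \int[mu]_(x in D `\` N) F x = \int[mu]_(x in D) F x.
Proof.
move=> mN N0 F0; apply/eqP; rewrite eq_le; apply/andP; split.
  apply: le_lower_integral => // x; rewrite /patch.
  case: ifPn => [/set_mem[Dx _]|_]; first by rewrite mem_set.
  by case: ifPn.
rewrite !ge0_integralE//; apply: ge_ereal_sup => _ [h /= hF <-].
apply: ereal_sup_ubound; exists (proj_nnsfun h (measurableC mN)) => [x|].
  rewrite /= mindicE; case: (boolP (x \in ~` N)) => [|] xN.
    rewrite mulr1; apply: le_trans (hF x) _; rewrite /patch.
    case: ifPn => [/set_mem Dx|_]; last by case: ifPn.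
    by rewrite mem_set//; split=> //; exact: set_mem.
  by rewrite mulr0 /patch; case: ifPn.
rewrite -mrestrict -integral_nnsfun; last exact: measurableC.
rewrite -integralT_nnsfun -setTD.
apply/esym/ge0_negligible_integral => //.
- by apply/measurable_EFinP; exact: measurable_funP.
- by move=> x _; rewrite lee_fin; exact: fun_ge0.
Qed.

End LowerIntegral.

(** * The Bochner integral over a set of finite measure *)

Section BochnerIntegral.
Context (d : measure_display) (T : measurableType d) (R : realType).
Context (mu : {measure set T -> \bar R}) (V : completeNormedModType R).
Context (D : set T) (mD : measurable D) (fD : (mu D < +oo)%E).

(** [V] carries no sigma-algebra here, so measurability is expressed through distances, which are
    pointwise limits of real step functions. *)
Lemma measurable_dist_lim (E : set T) (g g' : nat -> T -> V) (f f' : T -> V) :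
  (forall n, step (g n)) -> (forall n, step (g' n)) ->
  (forall x, E x -> g n x @[n --> \oo] --> f x) ->
  (forall x, E x -> g' n x @[n --> \oo] --> f' x) ->
  measurable_fun E (fun x => `|f x - f' x|%:E).
Proof.
move=> sg sg' gf gf'; apply/measurable_EFinP.
apply: (@measurable_fun_cvg _ _ _ _ (fun n x => `|g n x - g' n x|)).
  by move=> n; apply: (step_measurable_fun (fun p => `|p.1 - p.2|)
    (step_pair (sg n) (sg' n))).
by move=> x Ex; apply: cvg_norm; apply: cvgB; [exact: gf|exact: gf'].
Qed.

Lemma measurable_dist_step (E : set T) (g : nat -> T -> V) (f : T -> V)
    (h : T -> V) : (forall n, step (g n)) -> step h ->
  (forall x, E x -> g n x @[n --> \oo] --> f x) ->
  measurable_fun E (fun x => `|f x - h x|%:E).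
Proof.
move=> sg sh cf; apply: (measurable_dist_lim (g' := fun=> h)) cf _ => // x _.
exact: cvg_cst.
Qed.

Lemma bochner_approx_step (f : T -> V) g : bochner_approx mu D f g ->
  forall n, step (g n).
Proof. by case=> sg _ _ n; exact: integrable_simple_step (sg n). Qed.

Lemma bochner_approx_common (f f' : T -> V) g g' :
  bochner_approx mu D f g -> bochner_approx mu D f' g' ->
  exists N, [/\ measurable N, mu N = 0%E,
    forall x, (D `\` N) x -> g n x @[n --> \oo] --> f x &
    forall x, (D `\` N) x -> g' n x @[n --> \oo] --> f' x].
Proof.
move=> [_ [N [mN N0 sub]] _] [_ [N' [mN' N'0 sub']] _].
exists (N `|` N'); split.
- exact: measurableU.
- by rewrite null_set_setU.
- move=> x [Dx /not_orP[nx _]]; apply: contrapT => h; apply: nx; apply: sub.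
  by move=> /(_ Dx).
- move=> x [Dx /not_orP[_ nx]]; apply: contrapT => h; apply: nx; apply: sub'.
  by move=> /(_ Dx).
Qed.

(** The basic estimate, from the triangle inequality. For [f' = f] it shows that the integrals of
    any two approximations are eventually close; in the limit it bounds the distance of two Bochner
    integrals. *)
Lemma simple_integral_approx_dist (f f' : T -> V) g g' (n m : nat) :
  bochner_approx mu D f g -> bochner_approx mu D f' g' ->
  (`|simple_integral mu D (g n) - simple_integral mu D (g' m)|%:E <=
   \int[mu]_(x in D) `|f x - g n x|%:E + \int[mu]_(x in D) `|f x - f' x|%:E
   + \int[mu]_(x in D) `|f' x - g' m x|%:E)%E.
Proof.
move=> fg fg'; have sg := bochner_approx_step fg.
have sg' := bochner_approx_step fg'.
have [N [mN N0 cf cf']] := bochner_approx_common fg fg'.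
apply: (le_trans (simple_integral_dist mD fD (sg n) (sg' m))).
(* Lower integrals need not be subadditive. Off the null set [N] the integrands are measurable, so
   there the integrals can be added. *)
rewrite -!(negligible_lower_integral D mN N0) //.
have mDN : measurable (D `\` N) by exact: measurableD.
have mff' := measurable_dist_lim sg sg' cf cf'.
have mfg := measurable_dist_step sg (sg n) cf.
have mfg' := measurable_dist_step sg' (sg' m) cf'.
rewrite -ge0_integralD// -ge0_integralD//;
  [|by move=> x _; rewrite adde_ge0|exact: emeasurable_funD].
apply: le_lower_integral => // [x _|x]; first by rewrite !adde_ge0.
rewrite /patch; case: ifP => // _; rewrite -!EFinD lee_fin.
rewrite [g n x - _](_ : _ = - (f x - g n x) + (f x - f' x) + (f' x - g' m x)).
  by apply: le_trans (ler_normD _ _) _; rewrite lerD2r;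
    apply: le_trans (ler_normD _ _) _; rewrite normrN.
by rewrite opprB !addrA !subrK.
Qed.

Lemma bochner_approx_lt (f : T -> V) g (e : R) : bochner_approx mu D f g ->
  0 < e -> \forall n \near \oo, (\int[mu]_(x in D) `|f x - g n x|%:E < e%:E)%E.
Proof.
move=> [_ _ /fine_cvgP[fin c]] e0.
have /cvgrPdist_lt/(_ _ e0) {}c := c.
near=> n; rewrite -[ltLHS]fineK; last by near: n.
rewrite lte_fin; apply: le_lt_trans (ler_norm _) _.
by rewrite -normrN -[- _]sub0r; near: n.
Unshelve. all: by end_near. Qed.

Let self_dist0 (f : T -> V) : (\int[mu]_(x in D) `|f x - f x|%:E = 0)%E.
Proof. by under eq_integral do rewrite subrr normr0; rewrite integral0. Qed.

Lemma simple_integral_approx_lt (f : T -> V) g g' (e : R) :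
  bochner_approx mu D f g -> bochner_approx mu D f g' -> 0 < e ->
  exists n0, forall n m, (n0 <= n)%N -> (n0 <= m)%N ->
    `|simple_integral mu D (g n) - simple_integral mu D (g' m)| < e.
Proof.
move=> fg fg' e0; have e20 : 0 < e / 2 by rewrite divr_gt0.
have [n1 _ h1] := bochner_approx_lt fg e20.
have [n2 _ h2] := bochner_approx_lt fg' e20.
exists (maxn n1 n2) => n m; rewrite !geq_max => /andP[n1n _] /andP[_ n2m].
rewrite -lte_fin; apply: le_lt_trans (simple_integral_approx_dist n m fg fg') _.
by rewrite self_dist0 adde0 [e]splitr EFinD; apply: lteD; [exact: h1|exact: h2].
Qed.

Lemma bochner_approx_cvg (f : T -> V) g : bochner_approx mu D f g ->
  cvg (simple_integral mu D (g n) @[n --> \oo]).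
Proof.
move=> fg; apply/cauchy_cvgP/cauchy_exP => e e0.
have [n0 h] := simple_integral_approx_lt fg fg e0.
exists (simple_integral mu D (g n0)); exists n0 => // m /= nm.
by rewrite -ball_normE /=; exact: h.
Qed.

(** The integrals of two approximations of [f] differ by a quantity tending to 0, so the limit
    selected in the definition is reached along every approximation; completeness excludes the
    default case. *)
Lemma bochner_integral_cvg (f : T -> V) g : bochner_approx mu D f g ->
  simple_integral mu D (g n) @[n --> \oo] --> bochner_integral mu D f.
Proof.
move=> fg; rewrite /bochner_integral; case: xgetP => [_ -> [g' fg' cg']|].
  have -> : (fun n => simple_integral mu D (g n)) =
      (fun n => simple_integral mu D (g n) - simple_integral mu D (g' n))
      \+ (fun n => simple_integral mu D (g' n)).
    by apply/funext => n /=; rewrite subrK.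
  rewrite -[X in _ --> X]add0r; apply: cvgD => //.
  apply/cvgr0Pnorm_lt => e e0; have [n0 h] := simple_integral_approx_lt fg fg' e0.
  by exists n0 => // n /= n0n; exact: h.
move=> /(_ (lim (simple_integral mu D (g n) @[n --> \oo]))) []; exists g => //.
exact: bochner_approx_cvg fg.
Qed.

Lemma bochner_integral_dist (f f' : T -> V) :
  bochner_integrable mu D f -> bochner_integrable mu D f' ->
  (`|bochner_integral mu D f - bochner_integral mu D f'|%:E <=
   \int[mu]_(x in D) `|f x - f' x|%:E)%E.
Proof.
move=> [g fg] [g' fg'].
have c := bochner_integral_cvg fg; have c' := bochner_integral_cvg fg'.
apply/lee_addgt0Pr => e e0; have e20 : 0 < e / 2 by rewrite divr_gt0.
have h : (fun n => `|simple_integral mu D (g n) - simple_integral mu D (g' n)|%:E)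
   @ \oo --> `|bochner_integral mu D f - bochner_integral mu D f'|%:E.
  by apply: cvg_EFin; [exact: nearW|apply: cvg_norm; exact: cvgB].
rewrite -(cvg_lim _ h)//; apply: lime_le; first by apply/cvg_ex; eexists; exact: h.
near=> n.
apply: le_trans (simple_integral_approx_dist n n fg fg') _.
rewrite [e]splitr EFinD [X in (X + _ <= _)%E]addeC -addeA leeD2l// leeD// ltW//.
  by near: n; exact: bochner_approx_lt fg e20.
by near: n; exact: bochner_approx_lt fg' e20.
Unshelve. all: by end_near. Qed.

Lemma bochner_integral_le (f f' : T -> V) (e : R) :
  bochner_integrable mu D f -> bochner_integrable mu D f' -> 0 <= e ->
  (forall x, D x -> `|f x - f' x| <= e) ->
  `|bochner_integral mu D f - bochner_integral mu D f'| <= e * fine (mu D).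
Proof.
move=> bf bf' e0 ff'; rewrite -lee_fin.
apply: (le_trans (bochner_integral_dist bf bf')).
apply: (@le_trans _ _ (\int[mu]_(x in D) (cst e%:E x))%E).
  apply: le_lower_integral => // x; rewrite /patch.
  by case: ifPn => // /set_mem Dx; rewrite lee_fin ff'.
by rewrite integral_cst// EFinM fineK// ge0_fin_numE.
Qed.

Lemma bochner_approxB (f f' : T -> V) g g' :
  bochner_approx mu D f g -> bochner_approx mu D f' g' ->
  bochner_approx mu D (f - f') (fun n => g n - g' n).
Proof.
move=> fg fg'; have sg := bochner_approx_step fg.
have sg' := bochner_approx_step fg'.
have [N [mN N0 cf cf']] := bochner_approx_common fg fg'.
have mDN : measurable (D `\` N) by exact: measurableD.
split.
- move=> n; apply: step_integrable_simple => //.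
  exact: (step_comp (fun p => p.1 - p.2) (step_pair (sg n) (sg' n))).
- exists N; split=> // x /= nx; apply: contrapT => nN; apply: nx => Dx.
  by apply: cvgB; [exact: cf|exact: cf'].
have mfg n := measurable_dist_step sg (sg n) cf.
have mfg' n := measurable_dist_step sg' (sg' n) cf'.
have [_ _ c] := fg; have [_ _ c'] := fg'.
have cc' : (\int[mu]_(x in D) `|f x - g n x|%:E +
    \int[mu]_(x in D) `|f' x - g' n x|%:E)%E @[n --> \oo] --> 0%E.
  by rewrite -[X in _ --> X]adde0; exact: cvgeD.
apply: (squeeze_cvge _ (cvg_cst 0%E) cc').
apply: nearW => n; apply/andP; split; first by apply: integral_ge0.
rewrite -!(negligible_lower_integral D mN N0)// -ge0_integralD//.
apply: le_lower_integral => // [x _|x]; first by rewrite adde_ge0.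
rewrite /patch; case: ifP => // _; rewrite -!EFinD lee_fin.
rewrite [X in `|X|](_ : _ = (f x - g n x) - (f' x - g' n x)).
  exact: ler_normB.
by rewrite /= !opprD addrACA.
Qed.

Lemma bochner_integralB (f f' : T -> V) :
  bochner_integrable mu D f -> bochner_integrable mu D f' ->
  bochner_integrable mu D (f - f') /\
  bochner_integral mu D (f - f') =
  bochner_integral mu D f - bochner_integral mu D f'.
Proof.
move=> [g fg] [g' fg']; have fgB := bochner_approxB fg fg'.
split; first by exists (fun n => g n - g' n).
rewrite -(cvg_lim _ (bochner_integral_cvg fgB))//; apply: cvg_lim => //.
have sB n : simple_integral mu D (g n - g' n) =
    simple_integral mu D (g n) - simple_integral mu D (g' n).
  apply: simple_integralB => //; first exact: bochner_approx_step fg n.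
  exact: bochner_approx_step fg' n.
rewrite (funext sB).
exact: cvgB (bochner_integral_cvg fg) (bochner_integral_cvg fg').
Qed.

Lemma step_bochner_integral (g : T -> V) : step g ->
  bochner_integrable mu D g /\
  bochner_integral mu D g = simple_integral mu D g.
Proof.
move=> sg; have gg : bochner_approx mu D g (fun=> g).
  split; first by move=> _; exact: step_integrable_simple.
    by apply: aeW => x _; exact: cvg_cst.
  by rewrite self_dist0; exact: cvg_cst.
split; first by exists (fun=> g).
by rewrite -(cvg_lim _ (bochner_integral_cvg gg))//; apply: cvg_lim => //; exact: cvg_cst.
Qed.

Lemma bochner_integral_cst (c : V) : bochner_integrable mu D (cst c) /\
  bochner_integral mu D (cst c) = fine (mu D) *: c.
Proof.
have sc : step (cst c : T -> V).
  split=> [|v].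
    by apply: sub_finite_set (finite_set1 c) => _ [x _ <-].
  rewrite preimage_cst; case: ifP => _; exact: measurable0 || exact: measurableT.
have [ic ->] := step_bochner_integral sc; split=> //.
rewrite (simple_integral_comp mD fD (phi := cst c) id (s := [:: c]) sc)//.
  by rewrite big_seq1 preimage_cst ifT ?setIT// inE.
by move=> _ [x _ <-]; rewrite /= inE.
Qed.

(** Dominated convergence for the norms of [f - g n], with the constant [B + B] as dominating
    function. *)
Lemma bounded_bochner_integrable (f : T -> V) g (B : R) :
  (forall n, step (g n)) ->
  (forall x, D x -> g n x @[n --> \oo] --> f x) ->
  (forall x, D x -> `|f x| <= B) -> (forall n x, D x -> `|g n x| <= B) ->
  bochner_integrable mu D f.
Proof.
move=> sg cf fB gB; exists g; split.
- by move=> n; exact: step_integrable_simple.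
- by apply: aeW => x Dx; exact: cf.
have := @dominated_convergence _ T R mu D mD (fun n x => `|f x - g n x|%:E)
  (cst 0%E) (cst (B + B)%:E).
case.
- by move=> n; exact: measurable_dist_step sg (sg n) cf.
- exact: measurable_cst.
- apply: aeW => x Dx; apply: cvg_EFin; first exact: nearW.
  rewrite -(normr0 V); apply: cvg_norm; rewrite -(subrr (f x)).
  by apply: cvgB; [exact: cvg_cst|exact: cf].
- apply/integrableP; split; first exact: measurable_cst.
  under eq_integral do rewrite abse_EFin.
  by rewrite integral_cst// lte_mul_pinfty// lee_fin.
- apply: aeW => x n Dx /=; rewrite lee_fin ger0_norm//.
  by apply: le_trans (ler_normB _ _) _; rewrite lerD ?fB ?gB.
by move=> _ _; rewrite integral0.
Qed.

End BochnerIntegral.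

(** * Translation invariance of Lebesgue measure and lower integrals *)

Section Translation.
Context (R : realType).
Local Notation mu := (@lebesgue_measure R).

Definition translate (t : R) : measurableTypeR R -> measurableTypeR R :=
  fun s => t + s.

Lemma measurable_translate (t : R) : measurable_fun setT (translate t).
Proof. exact: measurable_funD. Qed.

HB.instance Definition _ (t : R) :=
  isMeasurableFun.Build _ _ _ _ (translate t) (measurable_translate t).

Lemma preimage_translate (t : R) (b b' : bool) (x y : R) :
  translate t @^-1` [set` Interval (BSide b x) (BSide b' y)] =
  [set` Interval (BSide b (x - t)) (BSide b' (y - t))].
Proof.
apply/funext => s; rewrite /preimage /translate /= !in_itv /=.
by case: b; case: b' => /=; rewrite ?lerBlDl ?ltrBlDl ?lerBrDl ?ltrBrDl.
Qed.

(** The image of Lebesgue measure under a translation agrees with it on half-open intervals, hence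
    everywhere by uniqueness. *)
Lemma lebesgue_measure_translate (t : R) (A : set R) : measurable A ->
  mu (translate t @^-1` A) = mu A.
Proof.
move=> mA; transitivity (pushforward mu (translate t) A) => //.
apply/esym/lebesgue_measure_unique => //= _ [[a b]] _ <-.
rewrite /pushforward preimage_translate !lebesgue_measure_itv/=.
by rewrite !lte_fin ltrD2r -!EFinD opprD addrACA subrr addr0.
Qed.

Local Open Scope ereal_scope.

Lemma ge0_integral_translate (t : R) (F : R -> \bar R) :
  measurable_fun setT F -> (forall x, 0 <= F x) ->
  \int[mu]_x F (t + x)%R = \int[mu]_x F x.
Proof.
move=> mF F0.
rewrite -[in LHS](preimage_setT (translate t)).
rewrite -(@ge0_integral_pushforward _ _ _ _ R _ (measurable_translate t) mu setT F)//.
by apply: eq_measure_integral => A mA _; exact: lebesgue_measure_translate.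
Qed.

Import HBNNSimple.

(** A simple function below the translated integrand, translated back by [- t], lies below [F] on
    [D] and keeps its integral. *)
Lemma lower_integral_translate (t : R) (D : set R) (F : R -> \bar R) :
  (forall x, 0 <= F x) ->
  \int[mu]_(x in translate t @^-1` D) F (t + x)%R <= \int[mu]_(x in D) F x.
Proof.
move=> F0; rewrite [leLHS]ge0_integralE//; apply: ge_ereal_sup => _ [h /= hF <-].
have mh : measurable_fun setT (fun x : measurableTypeR R => (h x)%:E).
  by apply/measurable_EFinP; exact: measurable_funP.
rewrite -integralT_nnsfun -(ge0_integral_translate (- t)) => [|//|x]; last first.
  by rewrite lee_fin; exact: fun_ge0.
apply: le_lower_integral => // [x _|x].
  by rewrite lee_fin; exact: fun_ge0.
rewrite patch_setT; apply: le_trans (hF _) _; rewrite /patch /translate.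
rewrite addrA subrr add0r; case: ifPn => [/set_mem /=|_]; last by case: ifPn.
by rewrite addrA subrr add0r => Dx; rewrite mem_set.
Qed.

End Translation.

(** * Integrals over a moving window *)

Section WindowIntegral.
Context (R : realType) (V : completeNormedModType R).
Local Notation mu := (@lebesgue_measure R).

Lemma bochner_integrable_subset (D D' : set R) (f : R -> V) :
  measurable D -> (mu D < +oo)%E -> measurable D' -> D' `<=` D ->
  bochner_integrable mu D f -> bochner_integrable mu D' f.
Proof.
move=> mD fD mD' DD' [g [sg cg ig]]; exists g; split.
- move=> n; apply: step_integrable_simple => //; last exact: integrable_simple_step (sg n).
  by apply: le_lt_trans fD; apply: le_measure => //; rewrite inE.
- by apply: filterS cg => x h /DD'; exact: h.
apply: (squeeze_cvge _ (cvg_cst 0%E) ig); apply: nearW => n.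
apply/andP; split; first by apply: integral_ge0 => x _; rewrite lee_fin.
apply: le_lower_integral => [x _|x _|x]; rewrite ?lee_fin// /patch.
case: ifPn => [/set_mem/DD' Dx|_]; first by rewrite mem_set.
by case: ifPn; rewrite lee_fin.
Qed.

Lemma step_translate (g : R -> V) (t : R) :
  @step _ (measurableTypeR R) _ g -> 
  @step _ (measurableTypeR R) _ (g \o translate t).
Proof.
move=> [fg mg]; split=> [|v].
  by apply: sub_finite_set fg => _ [x _ <-]; exists (translate t x).
rewrite comp_preimage -[X in measurable X]setTI.
exact: measurable_translate.
Qed.

Lemma bochner_integrable_translate (D : set R) (f : R -> V) (t : R) :
  measurable D -> (mu D < +oo)%E -> bochner_integrable mu D f ->
  bochner_integrable mu (translate t @^-1` D) (fun s => f (t + s)).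
Proof.
move=> mD fD [g [sg [N [mN N0 sub]] ig]].
exists (fun n => g n \o translate t); split.
- move=> n; apply: step_integrable_simple.
  + by rewrite -[X in measurable X]setTI; exact: measurable_translate.
  + by rewrite [X in (X < _)%E](lebesgue_measure_translate t mD).
  + exact/step_translate/integrable_simple_step/(sg n).
- exists (translate t @^-1` N); split.
  + by rewrite -[X in measurable X]setTI; exact: measurable_translate.
  + exact: (eq_trans (lebesgue_measure_translate t mN)).
  + by move=> x h; apply: sub => h'; apply: h => /h'.
apply: (squeeze_cvge _ (cvg_cst 0%E) ig); apply: nearW => n.
apply/andP; split; first by apply: integral_ge0 => x _; rewrite lee_fin.
apply: (@lower_integral_translate R t D (fun x => `|f x - g n x|%:E)) => x.
by rewrite lee_fin.
Qed.

Lemma preimage_translate_window (t h : R) :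
  translate t @^-1` `[t, t + h]%classic = `[0, h]%classic.
Proof. by rewrite preimage_translate subrr addrC addKr. Qed.

Lemma lebesgue_measure_window (t h : R) : 0 <= h ->
  mu `[t, t + h] = h%:E.
Proof.
move=> h0; rewrite lebesgue_measure_itv/= lte_fin ltrDl.
move: h0; rewrite le_eqVlt => /predU1P[<-|h0]; first by rewrite ltxx.
by rewrite h0 -EFinD addrC addKr.
Qed.

Lemma bochner_integrable_window (D : set R) (f : R -> V) (t h : R) : 0 <= h ->
  measurable D -> (mu D < +oo)%E -> `[t, t + h] `<=` D ->
  bochner_integrable mu D f -> bochner_integrable mu `[0, h] (fun s => f (t + s)).
Proof.
move=> h0 mD fD tD bf; rewrite -(preimage_translate_window t).
apply: bochner_integrable_translate => //.
  by rewrite lebesgue_measure_window// ltry.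
exact: bochner_integrable_subset bf.
Qed.

Definition window_integral (h : R) (f : R -> V) (t : R) : V :=
  bochner_integral mu `[0, h] (fun s => f (t + s)).

Lemma fine_measure_windowB (A : set R) (h t t' : R) : 0 <= h -> measurable A ->
  fine (mu (`[t, t + h] `&` A)) <= fine (mu (`[t', t' + h] `&` A)) + `|t - t'|.
Proof.
move=> h0 mA.
have fin (s k : R) : 0 <= k -> mu (`[s, s + k] `&` A) \is a fin_num.
  move=> k0; rewrite ge0_fin_numE//.
  apply: (@le_lt_trans _ _ (mu `[s, s + k])).
    by apply: le_measure; rewrite ?inE//; exact: measurableI.
  by rewrite lebesgue_measure_window// ltry.
(* The part of the window at [t] outside the window at [t'] lies in [[t, t']] if [t <= t'], and in
   [[t' + h, t + h]] otherwise; [c] is the left end. *)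
pose c := if t <= t' then t else t' + h.
have cov : `[t, t + h] `&` A `<=` (`[t', t' + h] `&` A) `|` `[c, c + `|t - t'|].
  move=> s [/=]; rewrite in_itv/= => /andP[ts st] As.
  have [/andP[t's st']|s'] := boolP ((t' <= s) && (s <= t' + h)).
    by left; split => //=; rewrite in_itv/= t's.
  right; rewrite /= in_itv/= /c; apply/andP.
  move: s'; rewrite negb_and -!ltNge => s'.
  case: (leP t t') => tt'.
    by rewrite distrC ger0_norm ?subr_ge0//; case/orP: s' => s'; split; lra.
  by rewrite gtr0_norm ?subr_gt0//; case/orP: s' => s'; split; lra.
rewrite -lee_fin EFinD !fineK ?fin//.
rewrite -(@lebesgue_measure_window c)//.
apply: le_trans (measureU2 _ _ _) => //; last exact: measurableI.
apply: le_measure => //; rewrite ?inE//; first exact: measurableI.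
by apply: measurableU => //; exact: measurableI.
Qed.

(** The window integral is the sum, over the values [v] of [g], of [v] times the measure of its
    fibre in the window. Each measure is 1-Lipschitz in [t], so the sum of the norms of the values
    is a Lipschitz constant. *)
Lemma step_window_lipschitz (g : R -> V) (h : R) : 0 <= h ->
  @step _ (measurableTypeR R) _ g ->
  exists C : R, forall t t',
    `|window_integral h g t - window_integral h g t'| <= C * `|t - t'|.
Proof.
move=> h0 sg.
have [s ss] : exists s : seq V, [set` s] = range g.
  by case: sg => /finite_seqP[s ->] _; exists s.
have us := undup_uniq s.
have mh : measurable (`[0, h] : set (measurableTypeR R)) by exact: measurable_itv.
have fh : (mu `[0%R, h]%classic < +oo)%E.
  by rewrite -[h]add0r lebesgue_measure_window// ltry.
have wE t : window_integral h g t =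
    \sum_(v <- undup s) fine (mu (`[t, t + h] `&` g @^-1` [set v])) *: v.
  have st := step_translate t sg.
  have [_] := step_bochner_integral mh fh st.
  rewrite /window_integral => ->.
  rewrite (simple_integral_comp mh fh (phi := g \o translate t) id (s := undup s) st us).
    apply: eq_bigr => v _; congr (fine _ *: _).
    rewrite comp_preimage -(preimage_translate_window t) -preimage_setI.
    apply: lebesgue_measure_translate; apply: measurableI => //.
    by case: sg => _; exact.
  move=> _ [x _ <-]; rewrite /= mem_undup.
  by have : range g (g (t + x)) by [exists (t + x)]; rewrite -ss.
exists (\sum_(v <- undup s) `|v|) => t t'.
rewrite !wE -sumrB; apply: le_trans (ler_norm_sum _ _ _) _.
rewrite mulr_suml; apply: ler_sum => v _; rewrite -scalerBl normrZ mulrC.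
have mv : measurable (g @^-1` [set v] : set (measurableTypeR R)) by case: sg.
have := fine_measure_windowB t t' h0 mv; have := fine_measure_windowB t' t h0 mv.
rewrite [`|t' - t|]distrC => h1 h2.
by rewrite ler_wpM2l// ler_distlC; apply/andP; split; lra.
Qed.

(** On [D], [f] is closer than [e / 4] in the integral norm to a step function, whose window
    integral is Lipschitz; replacing [f] by it changes each window integral by less than [e / 4]. *)
Lemma window_integral_uniform (D : set R) (f : R -> V) (h e : R) : 0 <= h ->
  measurable D -> (mu D < +oo)%E -> bochner_integrable mu D f -> 0 < e ->
  exists2 r : R, 0 < r & forall t t',
    `[t, t + h] `<=` D -> `[t', t' + h] `<=` D -> `|t - t'| < r ->
    `|window_integral h f t - window_integral h f t'| < e.
Proof.
move=> h0 mD fD bf e0; have [g fg] := bf.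
have e40 : 0 < e / 4 by rewrite divr_gt0.
have [n _ /(_ n (leqnn n)) gn] := bochner_approx_lt fg e40.
have sg := bochner_approx_step fg n.
have [C hC] := step_window_lipschitz h0 sg.
have mh : measurable (`[0, h] : set (measurableTypeR R)) by exact: measurable_itv.
have fh : (mu `[0%R, h]%classic < +oo)%E.
  by rewrite -[h]add0r lebesgue_measure_window// ltry.
have close t : `[t, t + h] `<=` D ->
    `|window_integral h f t - window_integral h (g n) t| < e / 4.
  move=> tD; rewrite -lte_fin; apply: le_lt_trans gn.
  have bft := bochner_integrable_window h0 mD fD tD bf.
  have [bgt _] := step_bochner_integral mh fh (step_translate t sg).
  apply: (le_trans (bochner_integral_dist mh fh bft bgt)).
  rewrite -(preimage_translate_window t).
  apply: (le_trans (@lower_integral_translate R t _ (fun x => `|f x - g n x|%:E) _)).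
    by move=> x; rewrite lee_fin.
  apply: le_lower_integral => [x _|x _|x]; rewrite ?lee_fin// /patch.
  case: ifPn => [/set_mem/tD Dx|_]; first by rewrite mem_set.
  by case: ifPn; rewrite lee_fin.
(* The added 1 keeps the denominator positive; the Lipschitz term is then at most [e / 4]. *)
exists (e / (4 * (`|C| + 1))) => [|t t' tD t'D tt'].
  by rewrite divr_gt0// mulr_gt0// ltr_wpDl.
have gtt' : `|window_integral h (g n) t - window_integral h (g n) t'| <= e / 4.
  apply: (le_trans (hC t t')).
  apply: (@le_trans _ _ ((`|C| + 1) * `|t - t'|)).
    by rewrite ler_wpM2r// ler_wpDr// ler_norm.
  rewrite mulrC; apply: (le_trans (ler_wpM2r _ (ltW tt'))); first by rewrite addr_ge0.
  have C0 : `|C| + 1 != 0 by rewrite gt_eqF// ltr_wpDl.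
  by rewrite invfM mulrA divfK.
have ft := close t tD; have := close t' t'D; rewrite distrC => ft'.
rewrite -(subrKA (window_integral h (g n) t)).
rewrite -[X in _ + X](subrKA (window_integral h (g n) t')).
apply: le_lt_trans (ler_normD _ _) _.
apply: le_lt_trans (lerD (lexx _) (ler_normD _ _)) _.
lra.
Qed.

End WindowIntegral.

(** * Continuity and integrability on the half-line or the line *)

Section Interval.
Context (R : realType) (V : completeNormedModType R) (J : set R).
Hypothesis hJ : J = `[0, +oo[%classic \/ J = setT.
Local Notation mu := (@lebesgue_measure R).

Lemma ray_up (t s : R) : J t -> t <= s -> J s.
Proof.
by case: hJ => -> //=; rewrite !in_itv/= !andbT; exact: le_trans.
Qed.

(** On the half-line the absolute value of [t] is [t], so a large one leaves room for a step to the
    left. *)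
Lemma ray_pred (t c : R) : J t -> 0 <= c -> c <= `|t| -> J (t - c).
Proof.
case: hJ => -> //=; rewrite !in_itv/= !andbT => t0 _.
by rewrite ger0_norm// subr_ge0.
Qed.

Lemma ray_closed : closed J.
Proof. by case: hJ => ->; [rewrite set_itvE; exact: closed_ge|exact: closedT]. Qed.

Lemma within_continuousP (f : R -> V) : {within J, continuous f} <->
  forall t e : R, J t -> 0 < e -> exists2 r : R, 0 < r &
    forall s, J s -> `|s - t| < r -> `|f s - f t| < e.
Proof.
rewrite subspace_continuousP; split=> [h t e Jt e0|h t Jt].
  have /cvgrPdist_lt/(_ _ e0) := h t Jt.
  rewrite near_withinE => /nbhs_ballP[r /= r0 hr]; exists r => // s Js st.
  by rewrite distrC; apply: hr => //; rewrite -ball_normE /= distrC.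
apply/cvgrPdist_lt => e e0; rewrite near_withinE; apply/nbhs_ballP.
have [r r0 hr] := h t e Jt e0; exists r => //= s; rewrite -ball_normE /= => st Js.
by rewrite distrC; apply: hr => //; rewrite distrC.
Qed.

Lemma ray_window_compact (a b : R) : compact (J `&` `[a, b]).
Proof.
apply: (subclosed_compact _ (@segment_compact _ a b)) => //.
by apply: closedI; [exact: ray_closed|exact: compact_closed (@segment_compact _ a b)].
Qed.

Lemma window_integral_continuous (f : R -> V) (h : R) : 0 <= h ->
  (forall K, compact K -> K `<=` J -> bochner_integrable mu K f) ->
  {within J, continuous (window_integral h f)}.
Proof.
move=> h0 bf; apply/within_continuousP => t e Jt e0.
(* [K] contains every window whose left end is in [J] within distance 1 of [t]. *)
pose K := J `&` `[t - 1, t + 1 + h].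
have cK : compact K by exact: ray_window_compact.
have mK : measurable (K : set (measurableTypeR R)) by exact: compact_measurable.
have [r r0 hr] := window_integral_uniform h0 mK (compact_finite_measure cK)
   (bf K cK (@subIsetl _ _ _)) e0.
have win s : J s -> `|s - t| < 1 -> `[s, s + h] `<=` K.
  move=> Js; rewrite ltr_distlC => /andP[ts st] x /=; rewrite !in_itv/= => /andP[sx xs].
  split; first exact: ray_up Js sx.
  by rewrite /= in_itv/=; apply/andP; split; lra.
exists (Num.min r 1) => [|s Js]; first by rewrite lt_min r0 ltr01.
rewrite lt_min => /andP[str st1]; apply: hr => //; first exact: win.
by apply: win => //; rewrite subrr normr0.
Qed.

(** Clamping to [[- M, M]] leaves finitely many values for the floor, and each fibre is the preimage
    of [[z, z + 1)] under a measurable function. *)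
Lemma floor_step (M k : R) : 0 <= M -> 0 < k ->
  @step _ (measurableTypeR R) _
    (fun x : R => Num.floor (Num.max (- M) (Num.min M x) * k)).
Proof.
move=> M0 k0; split=> [|z].
  pose N := (`|Num.floor (M * k)| + `|Num.floor (- M * k)|)%N.
  have fin : finite_set ((fun i : nat => i%:Z - N%:Z) @` `I_(N + N).+1).
    by apply: finite_image; exact: finite_II.
  apply: sub_finite_set fin => _ [x _ <-].
  set y := Num.max _ _.
  have yM : - M <= y <= M.
    by rewrite /y le_max lexx /= ge_max ge_min lexx andbT; lra.
  have /andP[My yM'] := yM.
  have l : Num.floor (- M * k) <= Num.floor (y * k).
    by apply: le_floor; rewrite ler_pM2r.
  have r : Num.floor (y * k) <= Num.floor (M * k).
    by apply: le_floor; rewrite ler_pM2r.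
  exists (absz (Num.floor (y * k) + N%:Z)).
    rewrite /= /N; lia.
  rewrite /N; lia.
pose F := (fun x : R => Num.max (- M) (Num.min M x) * k).
rewrite (_ : _ @^-1` _ = F @^-1` `[z%:~R, (z + 1)%:~R[); last first.
  by apply/seteqP; split=> x; rewrite /preimage /= in_itv/= -floor_eq => /eqP.
rewrite -[X in measurable X]setTI.
suff : measurable_fun [set: measurableTypeR R] F by apply => //; exact: measurable_itv.
apply: measurable_funM => //; apply: measurable_maxr => //.
exact: measurable_minr.
Qed.

(** [f] is sampled at points rounded down to a grid of mesh [1 / (n + 1)]. The samples are step
    functions, converge by continuity, and are bounded on [K] by compactness. *)
Lemma continuous_bochner_integrable (f : R -> V) (K : set R) :
  {within J, continuous f} -> compact K -> K `<=` J ->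
  bochner_integrable mu K f.
Proof.
move=> cf cK KJ.
have [M M0 KM] : exists2 M : R, 0 <= M & forall x, K x -> - M <= x <= M.
  have [N [_ hN]] := compact_bounded cK.
  exists (`|N| + 1) => [|x Kx]; first by rewrite addr_ge0.
  rewrite -ler_norml; apply: (hN (`|N| + 1)) => //.
  by rewrite ltr_pwDr// ler_norm.
(* Rounding down moves a point of [K] to the left by at most 1, hence into [K']. *)
pose K' := J `&` `[- M - 1, M].
have [B hB] : exists B : R, forall x, K' x -> `|f x| <= B.
  have cfK' : compact (f @` K').
    apply: continuous_compact; last exact: ray_window_compact.
    exact: continuous_subspaceW (@subIsetl _ _ _) cf.
  have [N [_ hN]] := compact_bounded cfK'.
  exists (N + 1) => x K'x; apply: (hN (N + 1)); first by rewrite ltrDl.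
  by exists x.
(* The clamp is the identity on [K]; it makes the set of sample points finite. *)
pose r n x : R := (Num.floor (Num.max (- M) (Num.min M x) * n.+1%:R))%:~R / n.+1%:R.
have clampE x : K x -> Num.max (- M) (Num.min M x) = x.
  by move=> /KM/andP[Mx xM]; rewrite (min_idPr xM) (max_idPr Mx).
have rE n x : K x -> x - n.+1%:R^-1 <= r n x <= x.
  move=> Kx; rewrite /r clampE//.
  have n0 : 0 < n.+1%:R :> R by rewrite ltr0n.
  have /andP[fx xf] := floor_itv (x * n.+1%:R).
  rewrite ler_pdivrMr// fx andbT ler_pdivlMr// mulrBl mulVf ?gt_eqF//.
  by rewrite lerBlDr -[1]/(1%:~R) -intrD ltW.
have inv1 n : n.+1%:R^-1 <= 1 :> R by rewrite invf_le1 ?ltr0n// ler1n.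
have rK' n x : K x -> K' (r n x).
  move=> Kx; have /andP[Mx xM] := KM x Kx; have /andP[rx xr] := rE n x Kx.
  split; last first.
    rewrite /= in_itv/= (le_trans xr xM) andbT; apply: le_trans rx.
    by rewrite lerB.
  have := KJ x Kx; case: hJ => -> //=; rewrite !in_itv/= !andbT => x0.
  by rewrite /r clampE// divr_ge0// ler0z floor_ge0 mulr_ge0.
apply: (@bounded_bochner_integrable _ (measurableTypeR R) R mu V K _ _ f
  (fun n => f \o r n) B).
- exact: compact_measurable.
- exact: compact_finite_measure.
- move=> n; pose G (z : int) := f (z%:~R / n.+1%:R).
  exact: (step_comp G (floor_step M0 (ltr0Sn _ n))).
- move=> x Kx; apply/cvgrPdist_lt => e e0.
  have [d d0 hd] := (within_continuousP f).1 cf x e (KJ x Kx) e0.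
  near=> n; rewrite distrC; apply: hd; first by have [] := rK' n x Kx.
  have /andP[rx xr] := rE n x Kx.
  rewrite distrC ger0_norm ?subr_ge0//.
  apply: (@le_lt_trans _ _ n.+1%:R^-1); first by rewrite lerBlDr -lerBlDl.
  by near: n; exact: near_infty_natSinv_lt (PosNum d0).
- move=> x Kx; apply: hB; split; first exact: KJ.
  have /andP[Mx xM] := KM x Kx; rewrite /= in_itv/= xM andbT; lra.
- by move=> n x Kx; apply: hB; exact: rK'.
Unshelve. all: by end_near. Qed.

End Interval.

(** * From decaying differences to continuity and uniform decay *)

Section Differences.
Context (R : realType) (V : completeNormedModType R) (J : set R).
Hypothesis hJ : J = `[0, +oo[%classic \/ J = setT.

(** For each [n] the bound holds on a closed set; these sets cover the half-line from [a], so by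
    Baire's theorem one of them contains an interval. *)
Lemma baire_ray (a e : R) (T : Type) (Q : nat -> set T) (k : T -> R -> V) :
  J a -> (forall n i, Q n i -> {within J, continuous (k i)}) ->
  (forall s, a <= s -> exists n, forall i, Q n i -> `|k i s| <= e) ->
  exists n, exists c : R, exists2 r : R, 0 < r &
    forall s, `|s - c| < r -> a < s /\ forall i, Q n i -> `|k i s| <= e.
Proof.
move=> Ja ck cov.
(* Absolute values fold the whole line onto the half-line from [a], so that Baire's theorem can be
   used on the line. *)
pose F n : set R := [set s | forall i, Q n i -> `|k i (a + `|s|)| <= e].
have openF n : open (~` F n).
  rewrite openE => s /existsNP[i /not_implyP[Qi /negP]]; rewrite -ltNge => es.
  have Js : J (a + `|s|) by apply: (ray_up hJ Ja); rewrite lerDl.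
  have d0 : 0 < `|k i (a + `|s|)| - e by rewrite subr_gt0.
  have [r r0 hr] := (within_continuousP J (k i)).1 (ck n i Qi) _ _ Js d0.
  apply/nbhs_ballP; exists r => //= s'; rewrite -ball_normE /= distrC => ss'.
  move=> /(_ i Qi); apply/negP; rewrite -ltNge.
  have Js' : J (a + `|s'|) by apply: (ray_up hJ Ja); rewrite lerDl.
  have := hr _ Js'; rewrite opprD addrACA subrr add0r.
  move=> /(_ (le_lt_trans (ler_dist_dist _ _) ss')) h.
  have := ler_normB (k i (a + `|s'|)) (k i (a + `|s'|) - k i (a + `|s|)).
  rewrite opprB addrC subrK; lra.
have [n [U [[x Ux] [oU UF]]]] : exists n, exists U : set R,
    U !=set0 /\ open U /\ U `<=` F n.
  apply: contrapT => nF.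
  have dF n : dense (~` F n).
    move=> U U0 oU; apply: contrapT => UF; apply: nF; exists n, U; split=> //.
    by split=> // y Oy; apply: contrapT => Fy; apply: UF; exists y.
  have := @Baire R R (fun n => ~` F n) (fun n => conj (openF n) (dF n)).
  move=> /(_ setT) []; [by exists 0|exact: openT|].
  move=> y [_ /= yF].
  have [n hn] := cov (a + `|y|) (ltac:(by rewrite lerDl)).
  exact: (yF n I hn).
have := oU; rewrite openE => /(_ x Ux) /nbhs_ballP[r /= r0 xrU].
(* The image under folding of the half of the ball about [x] that points away from 0; it lies to the
   right of [a]. *)
exists n, (a + `|x| + r / 2), (r / 2); first by rewrite divr_gt0.
move=> s; rewrite ltr_distlC => /andP[s1 s2].
have xs : `|x| < s - a by lra.
have xs' : s - a < `|x| + r by lra.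
have x0 : 0 <= `|x| by [].
split; first by lra.
(* Of the two points [s - a] and [- (s - a)] folded onto [s], the one on the side of [x] lies in the
   ball. *)
suff [y Fy ya] : exists2 y, F n y & `|y| = s - a.
  by move=> i Qi; have := Fy i Qi; rewrite ya addrC subrK.
have [x_ge0|x_lt0] := leP 0 x.
  exists (s - a); last by rewrite ger0_norm//; lra.
  apply/UF/xrU; rewrite -ball_normE /= distrC ger0_norm.
    by move: xs'; rewrite ger0_norm//; lra.
  by move: xs; rewrite ger0_norm//; lra.
exists (- (s - a)); last by rewrite normrN ger0_norm//; lra.
apply/UF/xrU; rewrite -ball_normE /= opprK.
move: xs xs'; rewrite ltr0_norm// => xs xs'.
rewrite ger0_norm; lra.
Qed.

Lemma within_continuousB (f g : R -> V) : {within J, continuous f} ->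
  {within J, continuous g} -> {within J, continuous (f - g)}.
Proof. by move=> cf cg x; apply: cvgB; [exact: cf|exact: cg]. Qed.

Lemma within_continuous_translate (f : R -> V) (t : R) : J t ->
  {within J, continuous f} -> {within J, continuous (fun s => f (t + s))}.
Proof.
move=> Jt /(within_continuousP J) cf; apply/(within_continuousP J) => s e Js e0.
have Jadd x : J x -> J (t + x).
  move: Jt; case: hJ => -> //=; rewrite !in_itv/= !andbT; exact: addr_ge0.
have [r r0 hr] := cf _ _ (Jadd s Js) e0.
exists r => // s' Js' ss'; apply: hr; first exact: Jadd.
by rewrite opprD addrACA subrr add0r.
Qed.

Section Decay.
Variable u : R -> V.
Hypothesis decay : forall s e : R, 0 < s -> 0 < e ->
  exists A : R, forall t, J t -> A < `|t| -> `|u (t + s) - u t| < e.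

(* Baire's theorem makes u nearly continuous at some c > t only; the continuity
   of the difference with step c - t carries this back to t. *)
Lemma continuous_of_differences :
  (forall s, 0 < s -> {within J, continuous (fun t => u (t + s) - u t)}) ->
  {within J, continuous u}.
Proof.
move=> cu; apply/(within_continuousP J) => t e Jt e0.
pose eta := e / 8; have eta0 : 0 < eta by rewrite divr_gt0.
(* [D m s] differs from [u s - u t] by a difference of [u] with step [s - t] at [t + m + 1], which
   tends to 0 as [m] grows. *)
pose D m s := (u (t + m.+1%:R) - u t) - (u (s + m.+1%:R) - u s).
have cD m : {within J, continuous (D m)}.
  apply: (@within_continuousB (cst _)); last by apply: cu.
  by move=> x; exact: cvg_cst.
have DE m s : D m s - (u s - u t) = - (u (s + m.+1%:R) - u (t + m.+1%:R)).
  rewrite /D !opprB (AC (2*2*2) ((1*4)*(5*2)*(3*6))) /=.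
  by rewrite !subrr !addr0.
have Dcvg s : t <= s -> exists n, forall m, (n <= m)%N ->
    `|D m s - (u s - u t)| < eta.
  rewrite le_eqVlt => /predU1P[<-|ts].
    by exists 0%N => m _; rewrite DE subrr oppr0 normr0.
  have ts0 : 0 < s - t by rewrite subr_gt0.
  have [A hA] := decay ts0 eta0.
  exists (Num.truncn (`|A| + `|t|)).+1 => m nm.
  have m1 : `|A| + `|t| < m.+1%:R.
    apply: lt_le_trans (truncnS_gt _) _; rewrite ler_nat; exact: leqW.
  have tm : A < t + m.+1%:R.
    have := ler_norm A; have := ler_norm (- t); rewrite normrN; lra.
  rewrite DE normrN (_ : s + m.+1%:R = t + m.+1%:R + (s - t)); last by lra.
  apply: hA; first by apply: ray_up hJ _ _ Jt _; rewrite lerDl.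
  by apply: lt_le_trans tm (ler_norm _).
(* Indexing by pairs makes Baire's theorem yield a Cauchy estimate for [D] uniform on an
   interval. *)
pose Q (n : nat) (p : nat * nat) := (n <= p.1)%N /\ (n <= p.2)%N.
have [n [c [r r0 hr]]] : exists n, exists c : R, exists2 r : R, 0 < r &
    forall s, `|s - c| < r -> t < s /\
      forall p, Q n p -> `|D p.1 s - D p.2 s| <= eta * 2.
  apply: (@baire_ray t (eta * 2) (nat * nat)%type Q (fun p s => D p.1 s - D p.2 s)) => //.
    by move=> n p _; exact: within_continuousB.
  move=> s /Dcvg[n hn]; exists n => -[m m'] [/= /hn h /hn h'].
  rewrite -(subrKA (u s - u t)); apply: le_trans (ler_normD _ _) _.
  by rewrite [X in _ + X]distrC; lra.
(* An index beyond both [n] and [n'] is inserted: the uniform Cauchy bound costs [2 * eta] and the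
   pointwise limit at [s] costs [eta]. *)
have Dn s : `|s - c| < r -> `|D n s - (u s - u t)| < eta * 3.
  move=> sc; have [ts hs] := hr s sc; have [n' hn'] := Dcvg s (ltW ts).
  have h1 := hs (n, maxn n n') (conj (leqnn n) (leq_maxl n n')).
  have h2 := hn' _ (leq_maxr n n').
  rewrite -(subrKA (D (maxn n n') s)); apply: le_lt_trans (ler_normD _ _) _.
  move: h1 h2 => /=; lra.
have cc : `|c - c| < r by rewrite subrr normr0.
have [tc _] := hr c cc; have Jc := ray_up hJ Jt (ltW tc).
have tc0 : 0 < c - t by rewrite subr_gt0.
have [r1 r10 hr1] := (within_continuousP J (D n)).1 (cD n) c eta Jc eta0.
have [r2 r20 hr2] :=
  (within_continuousP J (fun x => u (x + (c - t)) - u x)).1 (cu _ tc0) t eta Jt eta0.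
exists (Num.min r (Num.min r1 r2)) => [|s Js]; first by rewrite !lt_min r0 r10.
rewrite !lt_min => /and3P[sr sr1 sr2].
have scE : s + (c - t) - c = s - t by lra.
have Dns : `|D n (s + (c - t)) - D n c| < eta.
  by apply: hr1; rewrite ?scE//; apply: ray_up hJ _ _ Js _; rewrite lerDl ltW.
have := Dn c cc; have := Dn (s + (c - t)); rewrite scE => /(_ sr).
have := hr2 s Js sr2; rewrite (_ : t + (c - t) = c); last by lra.
move: Dns; set a := D n _; set b := D n c; set x := u (s + _); set y := u c.
set p := u s; set q := u t => hab hd hx hy.
(* The errors are [3 * eta] twice, from [Dn] at [s + (c - t)] and at [c], and [eta] twice, from the
   continuity of [D n] and of the difference with step [c - t]: together [8 * eta = e]. *)
have -> : p - q = (x - q) - (y - q) - (x - p - (y - q)).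
  rewrite !opprB opprD !opprB (AC (2*2*(2*2)) ((5*2)*(1*6)*(3*8)*(7*4))) /=.
  by rewrite !subrr !addr0.
rewrite -(subrKA a (x - q)) -(subrKA b a).
have := ler_normB (x - q - a + (a - b + (b - (y - q)))) (x - p - (y - q)).
have := ler_normD (x - q - a) (a - b + (b - (y - q))).
have := ler_normD (a - b) (b - (y - q)).
move: hx; rewrite [`|a - (x - q)|]distrC; move: hab hd hy; rewrite /eta.
lra.
Qed.

Hypothesis cu : {within J, continuous u}.

(** Baire's theorem in the shift [s] gives uniformity for [s] near some [c]; stepping back by [c]
    moves it to [[0, r / 2]], and finitely many such pieces cover [[0, h]]. *)
Lemma uniform_decay (h e : R) : 0 < e -> exists A : R,
  forall t s, J t -> A < `|t| -> 0 <= s <= h -> `|u (t + s) - u t| <= e.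
Proof.
move=> e0; have e30 : 0 < e / 3 by rewrite divr_gt0.
have J1 : J 1 by case: hJ => -> //=; rewrite in_itv/= ler01.
pose Q (n : nat) (t : R) := J t /\ n%:R <= `|t|.
have [n [c [r r0 hr]]] : exists n, exists c : R, exists2 r : R, 0 < r &
    forall s, `|s - c| < r -> 1 < s /\
      forall t, Q n t -> `|u (t + s) - u t| <= e / 3.
  apply: (@baire_ray 1 (e / 3) R Q (fun t s => u (t + s) - u t)) => //.
    move=> _ t [Jt _]; apply: (@within_continuousB _ (cst (u t))).
      exact: within_continuous_translate.
    by move=> x; exact: cvg_cst.
  move=> s s1; have [A hA] := decay (lt_le_trans ltr01 s1) e30.
  exists (Num.truncn `|A|).+1 => t [Jt nt]; apply/ltW/hA => //.
  by apply: lt_le_trans nt; apply: le_lt_trans (ler_norm _) (truncnS_gt _).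
have c0 : 0 < c by have [] := hr c (ltac:(by rewrite subrr normr0)); lra.
(* Both [t + s] and [t] are compared with [t - c], through the shifts [c + s] and [c], at a cost of
   [e / 3] each. *)
have small t s : J t -> n%:R + c <= `|t| -> 0 <= s <= r / 2 ->
    `|u (t + s) - u t| <= e / 3 + e / 3.
  move=> Jt nt /andP[s0 sr].
  have n0 : 0 <= n%:R :> R by [].
  have Qt : Q n (t - c).
    split; first by apply: ray_pred hJ _ _ Jt (ltW c0) _; lra.
    have := lerB_dist t c; rewrite (gtr0_norm c0); lra.
  have [_ /(_ _ Qt)] := hr (c + s) (ltac:(by rewrite addrAC subrr add0r ger0_norm//; lra)).
  have [_ /(_ _ Qt)] := hr c (ltac:(by rewrite subrr normr0)).
  rewrite subrK (_ : t - c + (c + s) = t + s); last by lra.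
  move=> h1 h2; have := ler_normB (u (t + s) - u (t - c)) (u t - u (t - c)).
  rewrite opprB addrA subrK; lra.
have r20 : 0 < r / 2 by rewrite divr_gt0.
(* Errors do not accumulate: beyond [w] the fixed shift [w] costs a fresh [e / 3] from [decay], and
   the remaining shift costs [2 * e / 3] from [small]. *)
have iter (k : nat) : exists A : R, forall t s, J t -> A < `|t| ->
    0 <= s <= k%:R * (r / 2) -> `|u (t + s) - u t| <= e.
  elim: k => [|k [A hA]].
    exists 0 => t s _ _; rewrite mul0r => /le_anti <-.
    by rewrite addr0 subrr normr0 ltW.
  pose w := k%:R * (r / 2); have w0 : 0 <= w by rewrite mulr_ge0// ltW.
  have [A' hA'] : exists A' : R, forall t, J t -> A' < `|t| ->
      `|u (t + w) - u t| <= e / 3.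
    move: w0; rewrite le_eqVlt => /predU1P[<-|w0].
      by exists 0 => t _ _; rewrite addr0 subrr normr0 ltW.
    by have [A' hA'] := decay w0 e30; exists A' => t Jt At; exact/ltW/hA'.
  (* The term [w] keeps the absolute value of [t + w] above [n + c], as [small] requires. *)
  exists (`|A| + `|A'| + n%:R + c + w) => t s Jt At /andP[s0].
  have n0 : 0 <= n%:R :> R by [].
  have [A0 A'0] : 0 <= `|A| /\ 0 <= `|A'| by [].
  have AA := ler_norm A; have AA' := ler_norm A'.
  rewrite -natr1 mulrDl mul1r => sk.
  have [sw|ws] := leP s w; first by apply: hA => //; [lra|rewrite s0].
  have := hA' t Jt (ltac:(lra)).
  have Jtw : J (t + w) by apply: ray_up hJ _ _ Jt _; rewrite lerDl.
  have := small (t + w) (s - w) Jtw.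
  have := lerB_dist t (- w); rewrite opprK normrN (ger0_norm w0) => tw.
  rewrite (_ : t + w + (s - w) = t + s); last by lra.
  move=> /(_ (ltac:(lra)) (ltac:(rewrite /w in ws *; lra))) h1 h2.
  rewrite -(subrKA (u (t + w))); apply: le_trans (ler_normD _ _) _; lra.
have [A hA] := iter (Num.truncn (`|h| / (r / 2))).+1; exists A => t s Jt At.
move=> /andP[s0 sh]; apply: hA => //; rewrite s0/=; apply: (le_trans sh).
rewrite -ler_pdivrMr//; apply: le_trans (ltW (truncnS_gt _)).
by rewrite ler_pM2r ?invr_gt0// ler_norm.
Qed.

(** The difference is the mean over [[0, h]] of [u t - u (t + s)], which is uniformly small; [e / 2]
    makes the final bound strict. *)
Lemma window_mean_decay (h e : R) : 0 < h -> 0 < e -> exists A : R,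
  forall t, J t -> A < `|t| -> `|u t - h^-1 *: window_integral h u t| < e.
Proof.
move=> h0 e0; have e20 : 0 < e / 2 by rewrite divr_gt0.
have [A hA] := @uniform_decay h (e / 2) e20; exists A => t Jt At.
have mh : measurable (`[0, h] : set (measurableTypeR R)) by exact: measurable_itv.
have fh : lebesgue_measure (`[0%R, h]%classic : set R) = h%:E.
  by rewrite -[h]add0r lebesgue_measure_window ?add0r// ltW.
have fh' : (lebesgue_measure (`[0%R, h]%classic : set R) < +oo)%E.
  by rewrite fh ltry.
pose K := `[t, t + h]%classic.
have cK : compact K by exact: segment_compact.
have KJ : K `<=` J.
  by move=> s; rewrite /K /= in_itv/= => /andP[ts _]; exact: (ray_up hJ Jt ts).
have bu := continuous_bochner_integrable hJ cu cK KJ.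
have buh := bochner_integrable_window (ltW h0) (compact_measurable cK)
  (compact_finite_measure cK) (@subset_refl _ _) bu.
have [bc ic] := bochner_integral_cst mh fh' (u t).
have := bochner_integral_le mh fh' buh bc (ltW e20).
rewrite ic; set m := fine _; have -> : m = h by exact: (congr1 fine fh).
move=> le.
have hn : h != 0 by rewrite gt_eqF.
rewrite (_ : u t - _ = - (h^-1 *: (window_integral h u t - h *: u t))); last first.
  by rewrite scalerBr scalerA mulVf// scale1r opprB.
rewrite normrN normrZ gtr0_norm ?invr_gt0// mulrC ltr_pdivrMr//.
apply: le_lt_trans (le _) _; last by rewrite ltr_pM2r//; lra.
move=> s; rewrite /= in_itv/= => sh; exact: hA.
Qed.

End Decay.
End Differences.

(** * The two properties for the complexification *)

Section MainTheorem.
Context (R : realType) (X : completeNormedModType R) (J : set R).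
Hypothesis hJ : J = `[0, +oo[%classic \/ J = setT.

Let E : completeNormedModType R := (X * X)%type.
Local Notation mu := (@lebesgue_measure R).

(** A complex scalar with zero imaginary part acts as the real scalar. *)
Lemma MeanE (h : R) (f : R -> E) (t : R) :
  @Mean R X h f t = h^-1 *: (window_integral h f t : E).
Proof.
rewrite /Mean /window_integral /cplx_scale /=.
case: (bochner_integral _ _ _) => y1 y2 /=.
by rewrite !scale0r subr0 add0r.
Qed.

Lemma L1loc_Mean_continuous (f : R -> E) (h : R) : 0 < h ->
  @L1loc R X J f -> @Cont R X J (@Mean R X h f).
Proof.
move=> h0 lf; rewrite /Cont /=.
have -> : @Mean R X h f = (fun t => h^-1 *: (window_integral h f t : E)).
  by apply/funext => t; rewrite MeanE.
move=> x; apply: (@cvgZl_tmp _ E).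
exact: (@window_integral_continuous R E J hJ f h (ltW h0) lf).
Qed.

Lemma Cont_L1loc (f : R -> E) : @Cont R X J f -> @L1loc R X J f.
Proof.
by move=> cf K; exact: (@continuous_bochner_integrable R E J hJ f K cf).
Qed.

(** Differences and means are shown to commute on [J] only, so membership has to be transferred
    along equality on [J]. *)
Lemma eq_C0 (f g : R -> E) : (forall t, J t -> f t = g t) ->
  @C0 R X J f -> @C0 R X J g.
Proof.
move=> fg [cf f0]; split.
  apply/(@within_continuousP R E J g) => t e Jt e0.
  have [r r0 hr] := (@within_continuousP R E J f).1 cf t e Jt e0.
  by exists r => // s Js; rewrite -!fg//; exact: hr.
move=> e e0; have [A hA] := f0 e e0; exists A => t Jt.
by rewrite -fg//; exact: hA.
Qed.

Lemma C0_stronger_Delta_property : stronger_Delta_property J (@C0 R X J).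
Proof.
move=> u du.
have decay (s e : R) : 0 < s -> 0 < e ->
    exists A : R, forall t, J t -> A < `|t| -> `|(u (t + s) : E) - u t| < e.
  by move=> s0 e0; have [_ /(_ e e0)] := du s s0.
have cu : @Cont R X J u.
  apply: (@continuous_of_differences R E J hJ u decay) => s s0.
  by have [] := du s s0.
split=> // h h0; split.
  exact: (@within_continuousB R E J u _ cu
    (L1loc_Mean_continuous h0 (Cont_L1loc cu))).
move=> e e0; have [A hA] := @window_mean_decay R E J hJ u decay cu h e h0 e0.
by exists A => t Jt At; rewrite [(u - _) t](_ : _ = u t - Mean h u t)// MeanE; exact: hA.
Qed.

Lemma Delta_Mean (f : R -> E) (s h t : R) : 0 < h -> 0 < s -> J t ->
  @L1loc R X J f ->
  @Delta R X s (@Mean R X h f) t = @Mean R X h (@Delta R X s f) t.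
Proof.
move=> h0 s0 Jt lf; rewrite /Delta !MeanE -scalerBr; congr (_ *: _).
have mh : measurable (`[0, h] : set (measurableTypeR R)) by exact: measurable_itv.
have fh : (mu (`[0%R, h]%classic : set R) < +oo)%E.
  by rewrite -[h]add0r lebesgue_measure_window ?ltry// ltW.
have bf r : J r -> bochner_integrable mu `[0, h] (fun x => f (r + x) : E).
  move=> Jr; have cK : compact `[r, r + h]%classic by exact: segment_compact.
  apply: (@bochner_integrable_window R E `[r, r + h]%classic f r h (ltW h0)) => //.
    exact: compact_finite_measure.
  by apply: lf => // x; rewrite /= in_itv/= => /andP[rx _]; exact: (ray_up hJ Jr rx).
have Jts : J (t + s) by apply: ray_up hJ _ _ Jt _; rewrite lerDl ltW.
have [_ <-] := bochner_integralB mh fh (bf _ Jts) (bf _ Jt).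
rewrite /window_integral; congr bochner_integral.
by apply/funext => r; rewrite /= [(_ - _) r]/= addrAC.
Qed.

Lemma DeltaC0_Delta_property : Delta_property J (@DeltaC0 R X J).
Proof.
move=> f lf df h h0; split.
  move=> K cK KJ.
  have [|] := @bochner_integralB _ (measurableTypeR R) R mu E K
    (compact_measurable cK) (compact_finite_measure cK) f (Mean h f) (lf K cK KJ) => //.
  by apply: Cont_L1loc cK KJ; exact: L1loc_Mean_continuous.
move=> s s0.
have [_ dd] := df s s0.
(* The result is [Delta s f - Mean h (Delta s f)], which on [J] equals [Delta s (f - Mean h f)]. *)
have [_ /(_ h h0)] := C0_stronger_Delta_property dd.
apply: eq_C0 => t Jt.
rewrite [LHS](_ : _ = Delta s f t - Mean h (Delta s f) t)//.
rewrite -Delta_Mean// /Delta.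
rewrite [RHS](_ : _ = (f (t + s) - Mean h f (t + s)) - (f t - Mean h f t))//.
by rewrite !opprD addrACA.
Qed.

End MainTheorem.

Theorem lemma3p6 (R : realType) (X : completeNormedModType R) (J : set R)
    (hJ : J = `[0, +oo[%classic \/ J = setT) :
  stronger_Delta_property J (@C0 R X J) /\ Delta_property J (@DeltaC0 R X J).
Proof.
split; [exact: C0_stronger_Delta_property|exact: DeltaC0_Delta_property].
Qed.
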